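(* Let $X$ be a crowded topological space which is either (a) locally compact, Hausdorff and second-countable, or (b) completely metrizable and of cardinality $\mathfrak c=2^{\aleph_0}$. Then $X$ is Baire $\mathfrak c$-resolvable: there is a partition $\{A_\iota:\iota<\mathfrak c\}$ of $X$ such that for every $\iota$ and every nonempty open $U\subseteq X$, the set $A_\iota\cap U$ is not meager.
   Context: Crowded means having no isolated points. A set is meager if it is a countable union of nowhere dense sets (sets whose closure has empty interior). *)

(* Defs.v *)
From HB Require Import structures.
From mathcomp Require Import all_boot all_order all_algebra.
From mathcomp Require Import all_classical all_reals.
From mathcomp Require Import topology.

Set Implicit Arguments.
Unset Strict Implicit.
Unset Printing Implicit Defensive.

Import Order.TTheory GRing.Theory Num.Theory.

Local Open Scope classical_set_scope.
Local Open Scope ring_scope.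

Definition crowded (X : topologicalType) : Prop := isolated [set: X] = set0.

Definition nowhere_dense (X : topologicalType) (A : set X) : Prop :=
  interior (closure A) = set0.

(* Finite unions are covered by padding with the empty set, which is nowhere
   dense. *)
Definition meager (X : topologicalType) (A : set X) : Prop :=
  exists2 F : nat -> set X,
    forall n, nowhere_dense (F n) & A = \bigcup_n F n.

Definition is_metric (R : realType) (X : Type) (d : X -> X -> R) : Prop :=
  [/\ forall x y, 0 <= d x y,
      forall x y, d x y = 0 <-> x = y,
      forall x y, d x y = d y x &
      forall x y z, d x z <= d x y + d y z].

Definition metric_induces_topology (R : realType) (X : topologicalType)
    (d : X -> X -> R) : Prop :=
  forall U : set X, open U <->
    forall x, U x -> exists2 e : R, 0 < e & [set y | d x y < e] `<=` U.

Definition metric_cauchy_seq (R : realType) (X : Type) (d : X -> X -> R)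
    (u : nat -> X) : Prop :=
  forall e : R, 0 < e ->
    exists N : nat, forall m n, (N <= m)%N -> (N <= n)%N -> d (u m) (u n) < e.

Definition metric_cvg_seq (R : realType) (X : Type) (d : X -> X -> R)
    (u : nat -> X) (l : X) : Prop :=
  forall e : R, 0 < e -> exists N : nat, forall n, (N <= n)%N -> d (u n) l < e.

Definition metric_complete (R : realType) (X : Type) (d : X -> X -> R) : Prop :=
  forall u : nat -> X, metric_cauchy_seq d u -> exists l, metric_cvg_seq d u l.

(* The library's completeType and metricType carry a chosen uniformity or
   distance (and completeType a base point), whereas here the topology of X is
   given and a compatible complete metric is only required to exist. *)
Definition completely_metrizable (R : realType) (X : topologicalType) : Prop :=
  exists d : X -> X -> R,
    [/\ is_metric d, metric_induces_topology d & metric_complete d].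

(* A type of cardinality 2^aleph_0, also used in place of the ordinals below
   the continuum to index the pieces of a partition. *)
Definition continuum : Type := nat -> bool.

Definition has_card_continuum (X : Type) : Prop :=
  ([set: X] #= [set: continuum])%card.

(* The library's [partition] also asks every piece to be nonempty. For nonempty
   X this follows from the last clause with U = X; omitting it only serves to
   include the empty space. *)
Definition Baire_resolvable (I : Type) (X : topologicalType) : Prop :=
  exists A : I -> set X,
    [/\ trivIset [set: I] A,
        cover [set: I] A = [set: X] &
        forall (i : I) (U : set X), open U -> U !=set0 -> ~ meager (A i `&` U)].

(* Main.v *)
Require Import Defs.
From Stdlib Require Wellfounded.
From HB Require Import structures.
From mathcomp Require Import all_boot all_order all_algebra.
From mathcomp Require Import all_classical all_reals.
From mathcomp Require Import topology wochoice lra.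

(** A Bernstein-type construction. If [U] is open and nonempty and [M] is meager,
    a Cantor scheme of open sets avoiding the nowhere dense pieces of [M] gives
    a sequence [s] whose range has closure contained in [U \ M] and of size
    continuum. There are only continuum many pairs of a sequence [s] in [X] and
    an index [i], so transfinite recursion along a well-order of the continuum
    with small initial segments picks pairwise distinct points
    [f s i \in closure (range s)]; the piece with index [i] collects the
    points [f s i]. Indexing by sequences rather than by G_delta sets is what
    makes the argument work for non-separable [X]. *)

Set Implicit Arguments.
Unset Strict Implicit.
Unset Printing Implicit Defensive.

Import Order.TTheory GRing.Theory Num.Theory.

Local Open Scope classical_set_scope.

(** * Well-orders and choice of distinct points *)

Definition contains_copy (T X : Type) (S : set X) : Prop :=
  exists2 g : T -> X, injective g & forall t, S (g t).

Lemma strict_well_order (T : Type) : exists lt : T -> T -> Prop,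
  well_founded lt /\ forall x y, x <> y -> lt x y \/ lt y x.
Proof.
have [R wR] := @well_ordering_principle {classic T}.
have totR : total R.
  by move=> x y; exact: (@wo_chainW _ R predT (withinW wR)).
have antiR : antisymmetric R.
  by move=> x y; exact: (@wo_chain_antisymmetric _ R predT (withinW wR)).
exists (fun x y => R x y /\ x <> y); split; last first.
  move=> x y xy; have /orP[h|h] := totR x y; [left|right]; split => //.
  by move=> yx; exact: xy.
move=> x; apply: contrapT => nAx.
pose P : {pred {classic T}} :=
  fun y => `[< ~ Acc (fun x y : T => R x y /\ x <> y) y >].
have [|z [[/asboolP nAz zmin] _]] := wR P.
  by exists x; apply/asboolP.
apply: nAz; constructor => y [Ryz yz]; apply: contrapT => nAy.
by apply: yz; apply: antiR; rewrite Ryz zmin//; apply/asboolP.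
Qed.

(* If some initial segment has a copy of T, pull the order back along an
   embedding into the least such segment. *)
Lemma initial_well_order (T : Type) : exists lt : T -> T -> Prop,
  [/\ well_founded lt, forall x y, x <> y -> lt x y \/ lt y x &
      forall t, ~ contains_copy T [set s | lt s t]].
Proof.
have [lt [wf tot]] := strict_well_order T.
have [[t0 ct0]|nex] := pselect (exists t, contains_copy T [set s | lt s t]);
  last by exists lt; split => // t ct; apply: nex; exists t.
have [t [g ginj glt] tmin] : exists2 t, contains_copy T [set s | lt s t] &
    forall s, lt s t -> ~ contains_copy T [set r | lt r s].
  elim/(well_founded_ind wf): t0 ct0 => t IH ct.
  have [[s [st cs]]|nex] :=
    pselect (exists s, lt s t /\ contains_copy T [set r | lt r s]).
    exact: IH cs.
  by exists t => // s st cs; apply: nex; exists s.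
exists (fun x y => lt (g x) (g y)); split.
- exact: Inverse_Image.wf_inverse_image.
- by move=> x y xy; apply: tot => /ginj.
- move=> s [h hinj hlt]; apply: (tmin (g s)); first exact: glt.
  by exists (g \o h) => //; exact: inj_comp.
Qed.

(** Transfinite recursion along an order whose initial segments contain no copy of [T]: the values
    chosen before stage [t] cannot exhaust the copy of [T] inside [F t]. *)
Lemma injective_choice (T X : Type) (F : T -> set X) :
  (forall t, contains_copy T (F t)) ->
  exists2 f : T -> X, injective f & forall t, F t (f t).
Proof.
move=> Fbig; have [lt [wf tot small]] := initial_well_order T.
have dflt (t : T) : X by have [g _ _] := cid2 (Fbig t); exact: g t.
pose new t (rec : forall s, lt s t -> X) x :=
  F t x /\ forall s (st : lt s t), rec s st <> x.
(* The value [dflt t] only makes [body] total; [fP] shows that a new point always exists. *)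
pose body t (rec : forall s, lt s t -> X) : X :=
  if pselect (exists x, new t rec x) is left p then sval (cid p) else dflt t.
pose f := Fix wf (fun=> X) body.
have fE t : f t = body t (fun s _ => f s).
  apply: Fix_eq => {}t u v uv; congr body.
  by do 2!apply: functional_extensionality_dep => ?.
have fP t : new t (fun s _ => f s) (f t).
  rewrite fE /body; case: pselect => [p|nex]; first exact: svalP (cid p).
  exfalso; have [g ginj gF] := Fbig t.
  (* If no point of [F t] were new, sending [s] to an earlier stage where [g s] was taken would
     embed [T] below [t]. *)
  have /choice[k kP] s : exists r, lt r t /\ f r = g s.
    apply: contrapT => nr; apply: nex; exists (g s); split; first exact: gF.
    by move=> r rt frgs; apply: nr; exists r.
  apply: (small t); exists k => [a b kab|s]; last exact: (kP s).1.
  by apply: ginj; rewrite -(kP a).2 -(kP b).2 kab.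
exists f; last by move=> t; have [] := fP t.
move=> x y fxy; apply: contrapT => /tot[xy|yx].
- by have [_ /(_ x xy)] := fP y; apply.
- by have [_ /(_ y yx)] := fP x; apply.
Qed.

(** * Cantor schemes and the Bernstein-type partition *)

Section cantor_scheme.
Context {X : topologicalType}.
Variable good : nat -> set X -> Prop.

(** [good] abstracts what differs between the two cases of the theorem. Shrinkability lets a scheme
    of good sets be built; convergence gives each of its branches a limit. *)
Definition shrinkable := forall n (V : set X), open V -> V !=set0 ->
  exists W, [/\ open W, W !=set0, closure W `<=` V & good n W].

(* Nested good sets act as a neighbourhood base of a common point. *)
Definition converging := forall W : nat -> set X,
  (forall n, open (W n)) -> (forall n, W n !=set0) ->
  (forall n, closure (W n.+1) `<=` W n) -> (forall n, good n (W n.+1)) ->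
  exists2 x, forall n, W n x & forall O, nbhs x O -> exists n, W n `<=` O.

Hypotheses (crX : crowded X) (hX : hausdorff_space X).
Hypotheses (shr : shrinkable) (cvg : converging).

Lemma crowded_two_points (V : set X) : open V -> V !=set0 ->
  exists x y, [/\ V x, V y & x != y].
Proof.
move=> oV [x Vx]; exists x; apply: contrapT => nex.
have : isolated [set: X] x.
  split; first by rewrite inE.
  exists V; first exact: open_nbhs_nbhs.
  rewrite setIT; apply/seteqP; split => [y Vy|y ->]//=.
  apply: contrapT => yx; apply: nex; exists y; split => //.
  by apply/eqP => xy; exact: yx.
by rewrite crX.
Qed.

Definition splits n (F V : set X) (W : bool -> set X) : Prop :=
  [/\ forall b, open (W b) /\ W b !=set0,
      forall b, closure (W b) `<=` V `\` F,
      forall b, good n (W b) & W true `&` W false = set0].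

Lemma exists_splits n (F V : set X) : nowhere_dense F -> open V -> V !=set0 ->
  exists W, splits n F V W.
Proof.
move=> nF oV V0; pose V' := V `\` closure F.
have oV' : open V'.
  by apply: openI => //; apply: closed_openC; exact: closed_closure.
have V'0 : V' !=set0.
  apply: contrapT => V'e; have [x Vx] := V0.
  have : interior (closure F) x.
    apply: (@filterS _ _ _ V); last exact: open_nbhs_nbhs.
    by move=> y Vy; apply: contrapT => nFy; apply: V'e; exists y.
  by rewrite nF.
have [x [y [V'x V'y xy]]] := crowded_two_points oV' V'0.
have := hX; rewrite open_hausdorff => /(_ _ _ xy)[[A B]]/=.
rewrite !inE => -[Ax By] [oA oB AB0].
have ex b : exists W, [/\ open W, W !=set0,
    closure W `<=` V' `&` (if b then A else B) & good n W].
  apply: shr; first by apply: openI => //; case: b.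
  by case: b; [exists x|exists y].
have [W WP] := choice ex; exists W; split.
- by move=> b; have [] := WP b.
- move=> b z; have [_ _ h _] := WP b; move=> /h[[Vz nFz] _]; split => //.
  by move=> Fz; apply: nFz; exact: subset_closure.
- by move=> b; have [] := WP b.
- apply/seteqP; split => // z [zt zf].
  rewrite -AB0; split.
  + by have [_ _ h _] := WP true; have [] := h _ (subset_closure zt).
  + by have [_ _ h _] := WP false; have [] := h _ (subset_closure zf).
Qed.

(** The latest bit comes first, so that passing to a child node is a cons. *)
Fixpoint prefix_rev (b : nat -> bool) n : seq bool :=
  if n is m.+1 then b m :: prefix_rev b m else [::].

Lemma size_prefix_rev b n : size (prefix_rev b n) = n.
Proof. by elim: n => //= n ->. Qed.

Lemma eq_prefix_rev b c n : (forall m, (m < n)%N -> b m = c m) ->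
  prefix_rev b n = prefix_rev c n.
Proof.
elim: n => //= n IH bc; rewrite bc// IH// => m mn.
by apply: bc; exact: ltnW.
Qed.

(** A canonical branch through the node [s], continued by [false]. *)
Definition branch (s : seq bool) : nat -> bool := nth false (rev s).

Lemma prefix_rev_branch s : prefix_rev (branch s) (size s) = s.
Proof.
elim: s => //= a s IH; congr cons.
  by rewrite /branch rev_cons nth_rcons size_rev ltnn eqxx.
rewrite -[RHS]IH; apply: eq_prefix_rev => m ms.
by rewrite /branch rev_cons nth_rcons size_rev ms.
Qed.

Lemma open_diff_meager_separable_copy (U : set X) (F : nat -> set X) :
  open U -> U !=set0 -> (forall n, nowhere_dense (F n)) ->
  exists s : nat -> X, contains_copy continuum (closure (range s)) /\
    closure (range s) `<=` U `\` \bigcup_n F n.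
Proof.
move=> oU U0 nF.
have /choice[S SP] (p : nat * set X) : exists W, open p.2 -> p.2 !=set0 ->
    splits p.1 (F p.1) p.2 W.
  have [[op p0]|nop] := pselect (open p.2 /\ p.2 !=set0).
    by have [W WP] := exists_splits p.1 (nF p.1) op p0; exists W.
  by exists (fun=> set0) => op p0; exfalso; exact: nop.
pose N := fix N (s : seq bool) : set X :=
  if s is b :: r then S (size r, N r) b else U.
have NP s : open (N s) /\ N s !=set0.
  elim: s => [|b s [oN N0]] //=.
  by have [] := SP (size s, N s) oN N0.
have NS s : splits (size s) (F (size s)) (N s) (fun b => N (b :: s)).
  by have [oN N0] := NP s; exact: SP (size s, N s) oN N0.
have Nbranch (b : nat -> bool) : exists x, (forall n, N (prefix_rev b n) x) /\
    forall O, nbhs x O -> exists n, N (prefix_rev b n) `<=` O.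
  have [|||n|x xN xO] := @cvg (fun n => N (prefix_rev b n)).
  - by move=> n; have [] := NP (prefix_rev b n).
  - by move=> n; have [] := NP (prefix_rev b n).
  - move=> n; have [_ h _ _] := NS (prefix_rev b n).
    by apply: subset_trans (h (b n)) _; exact: subDsetl.
  - have [_ _ h _] := NS (prefix_rev b n).
    by have := h (b n); rewrite size_prefix_rev.
  - by exists x; split.
have [x xP] := choice Nbranch.
(* The limits of the eventually false branches, enumerated by codes of nodes; a [k] coding no node
   gives the root's branch. *)
pose s k := x (branch (odflt [::] (unpickle k))).
exists s; split.
  exists x => [b c xbc|b].
    apply: contrapT => bc.
    have ex : exists n, b n != c n.
      apply: contrapT => nex; apply: bc; apply/funext => n.
      by apply: contrapT => bcn; apply: nex; exists n; apply/eqP.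
    (* At the first differing bit the branches enter disjoint children of a common node. *)
    have bcn := ex_minnP ex; case: bcn => n bcn nmin.
    have pre : prefix_rev b n = prefix_rev c n.
      apply: eq_prefix_rev => m mn; apply/eqP; apply: contraT => bcm.
      by move: (nmin _ bcm); rewrite leqNgt mn.
    have [_ _ _ disj] := NS (prefix_rev b n).
    have xb := (xP b).1 n.+1; have xc := (xP c).1 n.+1.
    rewrite /= -pre -xbc in xc; rewrite /= in xb.
    suff : set0 (x b) by [].
    by rewrite -disj; move: bcn xb xc; case: (b n); case: (c n).
  (* Some node along [b] lies in [O], and it contains the limit of its own canonical branch, a term
     of [s]. *)
  move=> O /(xP b).2[n NO].
  exists (x (branch (prefix_rev b n))); split.
    by exists (pickle (prefix_rev b n)) => //; rewrite /s pickleK.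
  apply: NO; have := (xP (branch (prefix_rev b n))).1 n.
  by rewrite -{2}(size_prefix_rev b n) prefix_rev_branch.
(* Each level has finitely many nodes, so the union of their closures is closed and captures the
   limits of [s] as well. *)
have level n : closure (range s) `<=`
    \bigcup_(t in [set: n.-tuple bool]) closure (N t).
  have -> : \bigcup_(t in [set: n.-tuple bool]) closure (N t) =
      closure (\bigcup_(t in [set: n.-tuple bool]) closure (N t)).
    apply/closure_id; apply: closed_bigcup; first exact: finite_finset.
    by move=> t _; exact: closed_closure.
  apply: closureS => _ [k _ <-].
  set b := branch (odflt [::] (unpickle k)).
  exists (tcast (size_prefix_rev b n) (in_tuple (prefix_rev b n))) => //.
  by rewrite val_tcast; apply: subset_closure; exact: (xP b).1.
(* [F n] is removed in passing from level [n] to level [n.+1], hence the use of [level n.+1]. *)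
have step n y : closure (range s) y -> U y /\ ~ F n y.
  have NU t : N t `<=` U.
    elim: t => // b t IH; have [_ h _ _] := NS t.
    apply: subset_trans IH; move=> z /subset_closure zN.
    by have [] := h b z zN.
  move=> /(level n.+1)[t _]; case/tupleP: t => b t.
  by have [_ h _ _] := NS t; move=> /h[/NU Uy]; rewrite size_tuple.
move=> y ys; split; first by have [] := step 0%N y ys.
by move=> [n _ Fny]; have [_] := step n y ys.
Qed.

Lemma Baire_resolvable_of_scheme (j : X -> continuum) : injective j ->
  Baire_resolvable continuum X.
Proof.
move=> jinj.
have [[x0 _]|X0] := pselect ([set: X] !=set0); last first.
  exists (fun=> set0); split.
  - by move=> i k _ _ [x []].
  - apply/seteqP; split => // x _; exfalso; by apply: X0; exists x.
  - by move=> i U _ [x _]; exfalso; apply: X0; exists x.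
have [g gj] : exists g : continuum -> X, cancel j g.
  have /choice[g gP] (c : continuum) : exists x, forall y, j y = c -> x = y.
    have [[y yc]|nex] := pselect (exists y, j y = c).
      by exists y => z zc; apply: jinj; rewrite yc zc.
    by exists x0 => y yc; exfalso; apply: nex; exists y.
  by exists g => y; exact: gP.
(* Each [t] codes a pair: column 0 is the index of a piece, and the later columns give, through [g],
   a sequence in [X]. *)
pose col (t : continuum) (n : nat) : continuum := fun m => t (pickle (n, m)).
have colsurj (q : nat -> continuum) : exists t, forall n, col t n = q n.
  exists (fun k => if unpickle k is Some (n, m) then q n m else false) => n.
  by apply/funext => m; rewrite /col pickleK.
pose sq t n := g (col t n.+1).
(* The fallback [setT] keeps every [K t] large, as [injective_choice] demands. *)
pose K t : set X :=
  if pselect (contains_copy continuum (closure (range (sq t)))) is left _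
  then closure (range (sq t)) else setT.
have [f finj fK] : exists2 f : continuum -> X, injective f & forall t, K t (f t).
  apply: injective_choice => t; rewrite /K; case: pselect => // _.
  have [|||s [[h hinj _] _]] :=
      @open_diff_meager_separable_copy setT (fun=> set0).
  - exact: openT.
  - by exists x0.
  - move=> _; rewrite /nowhere_dense closure0.
    by apply/seteqP; split => // x /interior_subset.
  - by exists h.
(* Injectivity of [f] makes the index of [f t] well defined; points outside its range may join any
   piece. *)
have /choice[i iP] (x : X) : exists i, forall t, f t = x -> col t 0%N = i.
  have [[t tx]|nex] := pselect (exists t, f t = x).
    by exists (col t 0%N) => r rx; congr (col _ _); apply: finj; rewrite tx rx.
  by exists (fun=> false) => t tx; exfalso; apply: nex; exists t.
exists (fun k => [set x | i x = k]); split.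
- by move=> k l _ _ [x [/= <- <-]].
- by apply/seteqP; split => // x _; exists (i x).
- move=> k U oU U0 [F nF AF].
  have [s [sbig sU]] := open_diff_meager_separable_copy oU U0 nF.
  (* For the code [t] of [(k, s)], the point [f t] is in piece [k] and in [U], yet outside every
     [F n]. *)
  have [t tP] := colsurj (fun n => if n is m.+1 then j (s m) else k).
  have st : sq t = s by apply/funext => n; rewrite /sq tP gj.
  have := fK t; rewrite /K st; case: pselect => // _ /sU[Uft].
  rewrite -AF; apply; split => //=.
  by rewrite -(iP (f t) t erefl) tP.
Qed.

End cantor_scheme.

Local Open Scope ring_scope.

Lemma nested_closures_le (X : topologicalType) (W : nat -> set X) :
  (forall n, closure (W n.+1) `<=` W n) ->
  forall m n, (m <= n)%N -> W n `<=` W m.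
Proof.
move=> WS m n /subnK <-; elim: (n - m)%N => // k; apply: subset_trans.
by apply: subset_trans (WS _); exact: subset_closure.
Qed.

(** * The locally compact, second-countable case *)

Section second_countable_locally_compact.
Context {X : topologicalType}.
Variable B : nat -> set X.
Hypotheses (oB : forall n, open (B n)).
Hypothesis Bbase : forall x O, nbhs x O -> exists2 n, B n x & B n `<=` O.
Hypotheses (lcX : locally_compact [set: X]) (hX : hausdorff_space X).

(** Compactness gives a branch a cluster point [x]. If [B n] contains [x], a node containing [x]
    that decides [B n] must lie inside it, so the nodes shrink to [x]. *)
Definition compact_deciding n (W : set X) :=
  compact (closure W) /\ (W `<=` B n \/ W `&` B n = set0).

Lemma shrinkable_compact_deciding : shrinkable compact_deciding.
Proof.
move=> n V oV V0.
have [V' [oV' V'0 V'V V'B]] : exists V', [/\ open V', V' !=set0, V' `<=` V &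
    V' `<=` B n \/ V' `&` B n = set0].
  have [VB|VB] := pselect (V `&` B n !=set0).
    exists (V `&` B n); split => //; first exact: openI.
    by left; exact: subIsetr.
  exists V; split => //; right; apply/seteqP; split => // x xVB.
  by apply: VB; exists x.
have [x V'x] := V'0; have [K] := @lcX x I; rewrite withinET => Kx [cK clK].
have [M Mx MV'] := compact_regular hX cK Kx (open_nbhs_nbhs (conj oV' V'x)).
exists (interior (M `&` K)).
have WV' : closure (interior (M `&` K)) `<=` V'.
  apply: subset_trans MV'; apply: closureS.
  by apply: subset_trans (@interior_subset _ _) _; exact: subIsetl.
split.
- exact: open_interior.
- by exists x; exact: filterI.
- exact: subset_trans V'V.
- split.
    apply: subclosed_compact cK _; first exact: closed_closure.
    rewrite {2}((closure_id K).1 clK); apply: closureS.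
    by apply: subset_trans (@interior_subset _ _) _; exact: subIsetr.
  have WV'2 : interior (M `&` K) `<=` V'.
    exact: subset_trans (@subset_closure _ _) WV'.
  case: V'B => V'B; [left; exact: subset_trans V'B|right].
  by apply/seteqP; split => // z [/WV'2 V'z Bz]; rewrite -V'B.
Qed.

Lemma converging_compact_deciding : converging compact_deciding.
Proof.
move=> W oW W0 WS Wgood.
have Wmono := nested_closures_le WS.
pose G := filter_from [set: nat] W.
have PG : ProperFilter G.
  apply: filter_from_proper => [|n _]; last exact: W0.
  apply: filter_from_filter; first by exists 0%N.
  move=> m n _ _; exists (maxn m n) => // x xW.
  by split; apply: Wmono xW; rewrite ?leq_maxl ?leq_maxr.
have [c1 _] := Wgood 0%N.
have [|x [_ xG]] := c1 G PG; first by exists 1%N => //; exact: subset_closure.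
have xW n : W n x.
  apply: WS; move: xG; rewrite clusterE; apply.
  by exists n.+1.
exists x => // O /Bbase[n Bnx BnO].
exists n.+1; have [_ [|WB]] := Wgood n; first by move/subset_trans; apply.
by suff : set0 x by []; rewrite -WB.
Qed.

(** Provides the injection of [X] into the continuum required by [Baire_resolvable_of_scheme]. *)
Lemma injective_base : injective (fun x n => `[< B n x >]).
Proof.
move=> x y xy; apply/eqP; apply: contraT => nxy.
have := hX; rewrite open_hausdorff => /(_ _ _ nxy)[[U V]]/=.
rewrite !inE => -[Ux Vy] [oU oV UV0].
have [n Bnx BnU] := Bbase (open_nbhs_nbhs (conj oU Ux)).
have := congr1 (fun h => h n) xy; rewrite /= asboolT// => /esym/asboolP/BnU Uy.
by suff : set0 y by []; rewrite -UV0.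
Qed.

End second_countable_locally_compact.

Lemma second_countable_sequence (X : topologicalType) : @second_countable X ->
  exists B : nat -> set X, (forall n, open (B n)) /\
    forall x O, nbhs x O -> exists2 n, B n x & B n `<=` O.
Proof.
move=> [Bs /countable_injP[f finj] [oBs Bbase]].
(* The [n]-th set is the base member with code [n], or empty if there is none. *)
exists (fun n => \bigcup_(U in [set U | Bs U /\ f U = n]) U); split.
  by move=> n; apply: bigcup_open => U [/oBs].
move=> x O /Bbase[U [BU Ux] UO]; exists (f U); first by exists U.
move=> y [V [BV fVU] Vy]; apply: UO.
by rewrite -(finj V U)// ?inE.
Qed.

(** * The completely metrizable case *)

Section complete_metric.
Context {R : realType} {X : topologicalType}.
Variable d : X -> X -> R.
Hypotheses (md : is_metric d) (td : metric_induces_topology d).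

Lemma metric_open_ball x e : open [set y | d x y < e].
Proof.
have [_ _ _ tri] := md; apply/td => y /= xy.
exists (e - d x y); first by rewrite subr_gt0.
by move=> z /= yz; have := tri x y z; lra.
Qed.

Lemma metric_nbhs_ball x e : 0 < e -> nbhs x [set y | d x y < e].
Proof.
have [_ d0 _ _] := md; move=> e0; apply: open_nbhs_nbhs.
by split; [exact: metric_open_ball|rewrite /= (d0 x x).2].
Qed.

Lemma metric_nbhsP x O : nbhs x O -> exists2 e, 0 < e & [set y | d x y < e] `<=` O.
Proof.
rewrite nbhsE => -[U [oU Ux] UO]; have [e e0 eU] := (td U).1 oU x Ux.
by exists e => //; exact: subset_trans UO.
Qed.

Lemma metric_hausdorff : hausdorff_space X.
Proof.
have [dge0 d0 dsym tri] := md.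
move=> p q clpq; apply/d0/eqP; rewrite eq_le dge0 andbT leNgt.
apply/negP => pq; have e0 : 0 < d p q / 2 by rewrite divr_gt0.
have [z [/= pz qz]] := clpq _ _ (metric_nbhs_ball p e0) (metric_nbhs_ball q e0).
by have := tri p z q; rewrite (dsym z q); lra.
Qed.

Definition small_diameter n (W : set X) :=
  forall x y, W x -> W y -> d x y < n.+1%:R^-1.

Lemma shrinkable_small_diameter : shrinkable small_diameter.
Proof.
have [_ d0 dsym tri] := md.
move=> n V oV [x Vx]; have [e e0 eV] := (td V).1 oV x Vx.
rewrite /small_diameter; have : 0 < n.+1%:R^-1 :> R by rewrite invr_gt0 ltr0n.
move: (n.+1%:R^-1) => k k0.
(* Closure points of the [r]-ball are within [2 * r] of [x], and its points within [2 * r] of each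
   other. *)
have [r [r0 re rk]] : exists r, [/\ 0 < r, 3 * r <= e & 3 * r <= k].
  exists (Num.min e k / 3).
  have : 0 < Num.min e k by rewrite lt_min e0.
  have : Num.min e k <= e by rewrite ge_min lexx.
  have : Num.min e k <= k by rewrite ge_min lexx orbT.
  by set m := Num.min _ _ => mk me m0; split; lra.
exists [set y | d x y < r]; split.
- exact: metric_open_ball.
- by exists x; rewrite /= (d0 x x).2.
- move=> y /(_ _ (metric_nbhs_ball y r0))[z [/= xz yz]].
  by apply: eV => /=; have := tri x z y; rewrite (dsym z y); lra.
- by move=> y z /= xy xz; have := tri y x z; rewrite (dsym y x); lra.
Qed.

Lemma converging_small_diameter : metric_complete d -> converging small_diameter.
Proof.
have [_ _ dsym _] := md.
move=> cd W oW W0 WS Wgood.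
have Wmono := nested_closures_le WS.
have arch (e : R) : 0 < e -> exists n : nat, n.+1%:R^-1 < e.
  move=> e0; exists (Num.truncn e^-1).
  rewrite invf_plt ?posrE ?ltr0n//.
  exact: truncnS_gt.
have [u uW] := choice W0.
have [|l ul] := cd u.
  move=> e /arch[n ne]; exists n.+1 => p q np nq.
  by apply: lt_trans ne; apply: (Wgood n); [exact: Wmono np _ _|exact: Wmono nq _ _].
(* The limit lies in the closure of [W n.+1], as the terms [u p] with [n < p] do. *)
have lW n : W n l.
  apply: WS => O /metric_nbhsP[e e0 eO]; have [N uN] := ul e e0.
  exists (u (maxn N n.+1)); split; first exact: Wmono (leq_maxr _ _) _ _.
  by apply: eO => /=; rewrite dsym; apply: uN; exact: leq_maxl.
exists l => // O /metric_nbhsP[e /arch[n ne] eO].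
exists n.+1 => y Wy; apply: eO => /=; apply: lt_trans ne.
exact: Wgood.
Qed.

End complete_metric.

Theorem theorem4p15 (R : realType) (X : topologicalType) :
  crowded X ->
  [/\ locally_compact [set: X], hausdorff_space X & @second_countable X] \/
  (completely_metrizable R X /\ has_card_continuum X) ->
  Baire_resolvable continuum X.
Proof.
move=> crX [[lcX hX /second_countable_sequence[B [oB Bbase]]]|
            [[d [md td cd]] cX]].
- exact: (Baire_resolvable_of_scheme crX hX (shrinkable_compact_deciding oB lcX hX)
    (converging_compact_deciding Bbase) (injective_base Bbase hX)).
- have [j [_ jinj _]] := card_set_bijP cX.
  apply: (Baire_resolvable_of_scheme crX (metric_hausdorff md td)
    (shrinkable_small_diameter md td) (converging_small_diameter md td cd)
    (j := j)).
  by move=> x y; apply: jinj; rewrite inE.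
Qed.
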